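(* Let $0<\varepsilon<1$. Assume that $u,-v\in \mathrm{USC}(\bar\Omega)$ satisfy $$-\Delta^\varepsilon_\infty u \leq -\Delta^\varepsilon_\infty v \quad \text{in } \Omega .$$ Suppose also that $-\Delta_\infty^\varepsilon u \leq 0$ in $\Omega$ or $-\Delta_\infty^\varepsilon v \geq 0$ in $\Omega$. Then $$\max_{\bar\Omega}(u-v)=\max_{\partial\Omega}(u-v).$$
   Context: $\Omega\subseteq\mathbb{R}^n$ is a bounded, connected, open set. For $x,y\in\bar\Omega$, $d(x,y)$ is the path distance: the infimum of the lengths of Lipschitz paths $\gamma:[0,1]\to\bar\Omega$ with $\gamma(0)=x$, $\gamma(1)=y$. It is assumed that $\operatorname{diam}(\Omega):=\sup\{d(x,y):x,y\in\bar\Omega\}<\infty$. Write $\bar\Omega(x,r):=\{y\in\bar\Omega: d(x,y)\le r\}$. $\mathrm{USC}(\bar\Omega)$ is the set of upper semicontinuous real-valued functions on $\bar\Omega$. For $\varepsilon>0$ set $\rho_\varepsilon(x,y):=\max\{d(x,y),\varepsilon\}$ if $x,y\in\Omega$, and $\rho_\varepsilon(x,y):=d(x,y)$ if $x\in\partial\Omega$ or $y\in\partial\Omega$. For $u:\bar\Omega\to\mathbb{R}$ and $x\in\Omega$, $$S^+_\varepsilon u(x):=\sup_{y\in\bar\Omega(x,\varepsilon)}\frac{u(y)-u(x)}{\rho_\varepsilon(x,y)},\quad S^-_\varepsilon u(x):=\sup_{y\in\bar\Omega(x,\varepsilon)}\frac{u(x)-u(y)}{\rho_\varepsilon(x,y)},\quad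 \Delta^\varepsilon_\infty u(x):=\frac1\varepsilon\big(S^+_\varepsilon u(x)-S^-_\varepsilon u(x)\big).$$ Inequalities involving $\Delta^\varepsilon_\infty$ are understood pointwise. *)

(* Defs.v *)
From mathcomp Require Import all_boot all_order all_algebra.
From mathcomp Require Import all_classical all_reals all_analysis.

Set Implicit Arguments.
Unset Strict Implicit.
Unset Printing Implicit Defensive.

Import Order.TTheory GRing.Theory Num.Theory.
Import numFieldNormedType.Exports.

Local Open Scope classical_set_scope.
Local Open Scope ring_scope.

Section Defs.
Context {R : realType} {n : nat}.
Implicit Types (x y : 'rV[R]_n) (gamma : R -> 'rV[R]_n) (A Omega : set 'rV[R]_n)
  (u : 'rV[R]_n -> R) (eps r : R).

(* The library norm `|x| on 'rV[R]_n is the sup norm: it induces the usual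
   topology, bounded sets and Lipschitz functions, but not Euclidean lengths. *)
Definition enorm x : R := Num.sqrt (\sum_(i < n) x 0 i ^+ 2).

(* Analogue of [variation] (which is for real-valued functions) on [0, 1];
   the nodes of the partition are 0 :: s. *)
Definition polygon_length gamma (s : seq R) : R :=
  let F := gamma \o nth 1 (0 :: s) in
  \sum_(0 <= k < size s) enorm (F k.+1 - F k).

Definition path_length gamma : \bar R :=
  ereal_sup [set (polygon_length gamma s)%:E | s in itv_partition 0 1].

Definition lipschitz_path Omega x y : set (R -> 'rV[R]_n) :=
  [set gamma | [/\ [lipschitz (gamma : R^o -> _) t | t in (`[0, 1] : set R^o)],
                   gamma @` `[0 : R, 1]%classic `<=` closure Omega,
                   gamma 0 = x & gamma 1 = y]].

(* +oo when no Lipschitz path in the closure joins x to y. *)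
Definition path_edist Omega x y : \bar R :=
  ereal_inf [set path_length gamma | gamma in lipschitz_path Omega x y].

Definition path_diam Omega : \bar R :=
  ereal_sup [set path_edist Omega x y | x in closure Omega & y in closure Omega].

(* Agrees with [path_edist] on the closure of Omega when
   [path_diam Omega < +oo]. *)
Definition path_dist Omega x y : R := fine (path_edist Omega x y).

Definition path_cball Omega x r : set 'rV[R]_n :=
  [set y | closure Omega y /\ path_dist Omega x y <= r].

Definition boundary A : set 'rV[R]_n := closure A `\` interior A.

Definition rho Omega eps x y : R :=
  if (x \in Omega) && (y \in Omega) then Num.max (path_dist Omega x y) eps
  else path_dist Omega x y.

(* The suprema live in \bar R: a real-valued upper semicontinuous u need not be
   bounded below, so [Sminus] may be +oo (and similarly [Splus] for a lower
   semicontinuous function). For these two classes of functions at most one of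
   the two suprema is infinite, so [inf_laplace] is never oo - oo. *)
Definition Splus Omega eps u x : \bar R :=
  ereal_sup [set ((u y - u x) / rho Omega eps x y)%:E
            | y in path_cball Omega x eps].

Definition Sminus Omega eps u x : \bar R :=
  ereal_sup [set ((u x - u y) / rho Omega eps x y)%:E
            | y in path_cball Omega x eps].

Definition inf_laplace Omega eps u x : \bar R :=
  ((eps^-1)%:E * (Splus Omega eps u x - Sminus Omega eps u x))%E.

(* Upper semicontinuity of the restriction of u to A. *)
Definition usc_on A u : Prop :=
  forall x, A x -> forall a : R, u x < a ->
    \forall y \near within A (nbhs x), u y < a.

Definition is_max_on A u (M : R) : Prop :=
  (u @` A) M /\ ubound (u @` A) M.

End Defs.

(* Main.v *)
Require Import Defs.
From mathcomp Require Import all_boot all_order all_algebra.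
From mathcomp Require Import all_classical all_reals all_analysis.
From mathcomp Require Import lra.

Set Implicit Arguments.
Unset Strict Implicit.
Unset Printing Implicit Defensive.

Import Order.TTheory GRing.Theory Num.Theory.
Import numFieldNormedType.Exports.
Local Open Scope classical_set_scope.
Local Open Scope ring_scope.

(** Let p maximize u - v over the closure of Omega, and suppose that no point of
    the boundary attains this maximum.

    At an interior point x where u - v is maximal, every difference quotient of
    u is below that of v, and every quotient of - u is above that of - v. Hence
    S^+ u <= S^+ v and S^- v <= S^- u at x, and the hypothesis
    S^+ v - S^- v <= S^+ u - S^- u forces S^+ u = S^+ v and S^- u = S^- v
    ([max_point_slopes]); semicontinuity on the compact closure bounds u above
    and v below, which excludes infinite slopes.

    Among the points where u - v is maximal, let x be one where u is largest.
    Then S^+ u (x) = 0 ([top_contact_slope0]): if this slope s were positive, the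
    points y that nearly realize it would satisfy u y >= u x + (a fixed positive
    amount), and since S^+ v (x) = s as well they would nearly maximize u - v;
    upper semicontinuity would then produce a maximum point of u - v at which u
    exceeds u x. As S^- u <= S^+ u when u is a subsolution, all four slopes at x
    are nonpositive, so u and v are constant on the path ball of radius eps
    about x, which therefore consists of points of the same kind as x.

    So the set of these points is closed, contained in Omega, and a neighbourhood
    of each of its points (a path ball is a Euclidean neighbourhood of an
    interior centre, because short segments lie in Omega). By connectedness it
    is all of Omega, which makes Omega closed; but a nonempty bounded open set
    has a boundary point ([open_bounded_boundary]). This is
    [comparison_subsolution]. If instead v is a supersolution, the same result
    is applied to the pair (- v, - u).

    Working with near-maximizers of the difference quotients, rather than with
    maximizers, lets Euclidean compactness of the closure stand in for
    compactness of path balls, which would rest on an Arzela-Ascoli argument. *)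

(** * Path distance and the Euclidean topology *)

Section PathDistance.
Context {R : realType} {n : nat}.
Implicit Types (x y : 'rV[R]_n) (Omega : set 'rV[R]_n).

Lemma enorm_ge0 x : 0 <= enorm x.
Proof. exact: sqrtr_ge0. Qed.

Lemma enormZ (a : R) x : enorm (a *: x) = `|a| * enorm x.
Proof.
rewrite /enorm -sqrtr_sqr -sqrtrM ?sqr_ge0// mulr_sumr.
by congr Num.sqrt; apply: eq_bigr => i _; rewrite mxE exprMn.
Qed.

Lemma normr_le_enorm x : `|x| <= enorm x.
Proof.
rewrite [leLHS]mx_normrE; apply/bigmax_leP; split=> [|[i j] _ /=].
  exact: enorm_ge0.
rewrite ord1 -sqrtr_sqr; apply: ler_wsqrtr.
by rewrite (bigD1 j)//= lerDl sumr_ge0// => k _; rewrite sqr_ge0.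
Qed.

Lemma enorm_le_normr x : enorm x <= n%:R * `|x|.
Proof.
have xi i : `|x 0 i| <= `|x|.
  by rewrite [leRHS]mx_normrE; apply: (le_bigmax _ _ (0 : 'I_1, i)).
rewrite -(@ger0_norm _ (n%:R * `|x|)) ?mulr_ge0// -sqrtr_sqr.
apply: ler_wsqrtr; rewrite exprMn.
apply: (@le_trans _ _ (\sum_(i < n) `|x| ^+ 2)).
  by apply: ler_sum => i _; rewrite -real_normK ?num_real// lerXn2r ?nnegrE.
rewrite sumr_const card_ord -[leLHS]mulr_natl ler_wpM2r ?sqr_ge0//.
by rewrite -natrX ler_nat; case: (n) => // m; rewrite -mulnn leq_pmulr.
Qed.

(** The trivial partition already gives a path at least the length of its chord. *)
Lemma path_edist_ge Omega x y : (`|y - x|%:E <= path_edist Omega x y)%E.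
Proof.
apply/ereal_infP => _ [gamma [_ _ g0 g1] <-].
have s01 : itv_partition (0 : R) 1 [:: 1] by split; rewrite /= ?ltr01.
apply: le_trans (ereal_sup_ubound _); last by exists [:: 1].
by rewrite /polygon_length /= big_nat1 /= g0 g1 lee_fin normr_le_enorm.
Qed.

Lemma path_dist_ge Omega x y : (path_edist Omega x y < +oo)%E ->
  `|y - x| <= path_dist Omega x y.
Proof.
move=> fin; have := path_edist_ge Omega x y.
by rewrite /path_dist; case: path_edist fin => //= r _; rewrite lee_fin.
Qed.

(** The lengths along a straight line telescope. *)
Lemma polygon_length_segment x y (s : seq R) : itv_partition (0 : R) 1 s ->
  polygon_length (fun t => x + t *: (y - x)) s = enorm (y - x).
Proof.
case=> s_sorted /eqP s_last; rewrite /polygon_length /=.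
rewrite (eq_big_nat _ _ (F2 := fun k =>
  (nth 1 (0 :: s) k.+1 - nth 1 (0 :: s) k) * enorm (y - x))); last first.
  move=> k /andP[_ ks]; rewrite /= opprD addrACA subrr add0r -scalerBl enormZ ger0_norm//.
  by rewrite subr_ge0 ltW//; move/(pathP 1): s_sorted; apply.
rewrite -mulr_suml telescope_sumr//.
by rewrite -(last_nth 1 0 s) s_last /= subr0 mul1r.
Qed.

Lemma path_dist_segment Omega x y :
  (forall t, 0 <= t <= 1 -> closure Omega (x + t *: (y - x))) ->
  path_dist Omega x y <= enorm (y - x).
Proof.
move=> seg.
suff : (path_edist Omega x y <= (enorm (y - x))%:E)%E.
  have := path_edist_ge Omega x y.
  by rewrite /path_dist; case: path_edist => //= r _; rewrite lee_fin.
apply: (@le_trans _ _ (path_length (fun t => x + t *: (y - x)))).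
  apply: ereal_inf_lbound; exists (fun t => x + t *: (y - x)) => //; split.
  - apply: (@klipschitzW _ _ _ `|y - x|).
      apply: (@globally_properfilter _ _ (0, 0)).
      by split; rewrite /= in_itv /= lexx ler01.
    move=> -[s t] _ /=.
    by rewrite opprD addrACA subrr add0r -scalerBl normrZ mulrC.
  - by move=> _ [t /= + <-]; rewrite in_itv /=; exact: seg.
  - by rewrite scale0r addr0.
  - by rewrite scale1r addrC subrK.
apply: ge_ereal_sup => _ [s s01 <-].
by rewrite polygon_length_segment.
Qed.

End PathDistance.

(** * Upper semicontinuous functions *)

Section Usc.
Context {R : realType} {n : nat}.
Implicit Types (A B : set 'rV[R]_n) (f g : 'rV[R]_n -> R).

Lemma usc_onW A B f : A `<=` B -> usc_on B f -> usc_on A f.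
Proof.
move=> AB fB x Ax a fxa; have := fB x (AB _ Ax) a fxa.
rewrite !near_withinE; by apply: filterS => y h /AB.
Qed.

Lemma usc_onD A f g : usc_on A f -> usc_on A g ->
  usc_on A (fun x => f x + g x).
Proof.
move=> fA gA x Ax a fga; pose e := (a - (f x + g x)) / 2.
have e0 : 0 < e by rewrite /e; lra.
have fx : f x < f x + e by lra.
have gx : g x < g x + e by lra.
have := fA x Ax _ fx; have := gA x Ax _ gx; rewrite !near_withinE.
by apply: filterS2 => y hg hf Ay; move: (hf Ay) (hg Ay); rewrite /e; lra.
Qed.

Lemma closed_superlevel A f (a : R) : closed A -> usc_on A f ->
  closed (A `&` [set x | a <= f x]).
Proof.
move=> Acl fA p pcl.
have Ap : A p by apply: Acl; apply: closureS pcl; exact: subIsetl.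
split=> //=; rewrite leNgt; apply/negP => fpa.
have [y [[Ay ay] /(_ Ay)]] := pcl _ (fA p Ap a fpa).
by move=> /= /lt_geF; rewrite ay.
Qed.

(** Extreme value theorem: the superlevel sets of f at its own values form a
    filter base of subsets of A, and f is maximal at each of its cluster
    points in A. *)
Lemma usc_on_max A f : compact A -> A !=set0 -> usc_on A f ->
  exists2 p, A p & forall x, A x -> f x <= f p.
Proof.
move=> Aco [x0 Ax0] fA.
pose F := filter_from A (fun z => A `&` [set w | f z <= f w]).
have Ff : ProperFilter F.
  apply: filter_from_proper; last by move=> z Az; exists z; split=> /=.
  apply: filter_from_filter; first by exists x0.
  (* superlevel sets are nested *)
  move=> y z Ay Az; case: (leP (f y) (f z)) => yz.
    by exists z => // w [Aw zw]; do 2!split => //=; exact: le_trans zw.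
  by exists y => // w [Aw zw]; do 2!split => //=; apply: le_trans zw; exact: ltW.
have [|p [Ap Fp]] := Aco F Ff; first by exists x0 => // w [].
exists p => // z Az; rewrite leNgt; apply/negP => pz.
have Fz : F (A `&` [set w | f z <= f w]) by exists z.
have [w [[Aw zw] /(_ Aw)/=]] := Fp _ _ Fz (fA p Ap _ pz).
by move=> /lt_geF; rewrite zw.
Qed.

End Usc.

(** * Bounded open sets *)

Section Boundary.
Context {R : realType} {n : nat}.
Implicit Types (Omega : set 'rV[R]_n).

Lemma bounded_closure Omega : bounded_set Omega -> bounded_set (closure Omega).
Proof.
case=> M [_ hM]; exists (M + 2); split; first exact: num_real.
move=> K MK p pcl; have [y [Oy]] := pcl _ (nbhsx_ballx p 1 ltr01).
rewrite -ball_normE /= => py.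
have yM : `|y| <= M + 1 by apply: hM => //; lra.
have := ler_normD (p - y) y; rewrite subrK; lra.
Qed.

(** A point of the closure with maximal first coordinate cannot be interior,
    since moving it slightly in that direction stays in an open set. *)
Lemma open_bounded_boundary Omega : (0 < n)%N -> Omega !=set0 ->
  bounded_set Omega -> open Omega -> exists2 z, closure Omega z & ~ Omega z.
Proof.
move=> n0 [x0 Ox0] Ob Oo; pose i : 'I_n := Ordinal n0.
have cl0 : closure Omega !=set0 by exists x0; exact: subset_closure.
have co : compact (closure Omega).
  exact: bounded_closed_compact (bounded_closure Ob) (@closed_closure _ _).
have coord : usc_on (closure Omega) (fun x : 'rV[R]_n => x 0 i).
  move=> x _ a xa.
  have : \forall y \near x, (y : 'rV[R]_n) 0 i < a.
    by apply: (@coord_continuous _ _ _ 0 i x) (fun t => t < a) _; exact: lt_nbhsl.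
  by apply: filterS.
have [p clp pmax] := usc_on_max co cl0 coord.
exists p => // Op; have /nbhs_ballP[r /= r0 br] : nbhs p Omega by exact: Oo.
pose q := p + (r / 2) *: delta_mx 0 i.
have Oq : Omega q.
  apply: br; rewrite -ball_normE /= /q opprD addNKr normrN normrZ.
  have d1 : `|delta_mx 0 i : 'rV[R]_n| <= 1.
    rewrite [leLHS]mx_normrE; apply/bigmax_leP; split=> // -[j k] _ /=.
    by rewrite mxE; case: (_ && _); rewrite /= ?normr1 ?normr0.
  rewrite gtr0_norm; last lra.
  by apply: (@le_lt_trans _ _ (r / 2 * 1)); [rewrite ler_wpM2l//; lra|lra].
have := pmax q (subset_closure Oq).
rewrite /q !mxE !eqxx /=; lra.
Qed.

End Boundary.

(** * One-sided slopes *)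

Section Slopes.
Context {R : realType} {n : nat} (Omega : set 'rV[R]_n) (eps : R).
Context (Omega_open : open Omega) (Omega_diam : (path_diam Omega < +oo)%E).
Context (eps_gt0 : 0 < eps).
Implicit Types (x y : 'rV[R]_n) (u v : 'rV[R]_n -> R).

Lemma path_edist_lty x y : closure Omega x -> closure Omega y ->
  (path_edist Omega x y < +oo)%E.
Proof.
move=> cx cy; apply: le_lt_trans Omega_diam.
by apply: ereal_sup_ubound; exists x => //; exists y.
Qed.

(** The weight does not degenerate near the boundary: it is at least eps at
    points of Omega, and boundary points are at a distance bounded below from
    the interior point x. *)
Lemma rho_gt0_unif x : Omega x ->
  exists2 c, 0 < c & forall y, closure Omega y -> c <= rho Omega eps x y.
Proof.
move=> Ox; have /nbhs_ballP[r /= r0 br] : nbhs x Omega by exact: Omega_open.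
exists (Num.min r eps); first by rewrite lt_min r0.
move=> y cy; rewrite /rho mem_set//=; case: ifPn => [_|yO].
  by apply: (@le_trans _ _ eps); rewrite ?ge_min ?le_max lexx orbT.
rewrite ge_min; apply/orP; left.
apply: le_trans (path_dist_ge (path_edist_lty (subset_closure Ox) cy)).
rewrite leNgt distrC; apply: contra yO => yx.
by apply: mem_set; apply: br; rewrite -ball_normE.
Qed.

Lemma rho_le x y : path_cball Omega x eps y -> rho Omega eps x y <= eps.
Proof. by case=> _ xy; rewrite /rho; case: ifP; rewrite // ge_max xy lexx. Qed.

(** Short segments issued from an interior point stay in Omega, so that near x
    the path distance is the Euclidean one. *)
Lemma path_cball_nbhs x : Omega x -> nbhs x (path_cball Omega x eps).
Proof.
move=> Ox; have /nbhs_ballP[r /= r0 br] : nbhs x Omega by exact: Omega_open.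
(* the Euclidean norm is at most n times the sup norm that defines balls *)
have n1 : 0 < n%:R + 1 :> R by rewrite ltr_wpDl.
apply/nbhs_ballP; exists (Num.min r (eps / (n%:R + 1))).
  by rewrite /= lt_min r0 divr_gt0.
move=> y; rewrite -ball_normE /= lt_min => /andP[xyr xye].
have seg t : 0 <= t <= 1 -> Omega (x + t *: (y - x)).
  move=> /andP[t0 t1]; apply: br.
  rewrite -ball_normE /= opprD addNKr normrN normrZ ger0_norm// (distrC y).
  by apply: le_lt_trans xyr; rewrite ler_piMl.
split.
  apply: subset_closure; have := seg 1.
  by rewrite scale1r addrC subrK lexx ler01; exact.
apply: le_trans (path_dist_segment (fun t ht => subset_closure (seg t ht))) _.
apply: le_trans (enorm_le_normr _) _; rewrite distrC.
move: xye; rewrite ltr_pdivlMr//.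
have := normr_ge0 (x - y); nra.
Qed.

Lemma SplusN v x : Splus Omega eps (fun y => - v y) x = Sminus Omega eps v x.
Proof.
rewrite /Splus /Sminus; congr ereal_sup.
by apply: eq_imagel => y _; rewrite opprK addrC.
Qed.

Lemma SminusN v x : Sminus Omega eps (fun y => - v y) x = Splus Omega eps v x.
Proof.
rewrite /Splus /Sminus; congr ereal_sup.
by apply: eq_imagel => y _; rewrite opprK addrC.
Qed.

Lemma Splus_ge u x y : path_cball Omega x eps y ->
  (((u y - u x) / rho Omega eps x y)%:E <= Splus Omega eps u x)%E.
Proof. by move=> xy; apply: ereal_sup_ubound; exists y. Qed.

Lemma Splus_ge0 u x : Omega x -> (0 <= Splus Omega eps u x)%E.
Proof.
move=> /path_cball_nbhs/nbhs_singleton/(Splus_ge u).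
by rewrite subrr mul0r.
Qed.

Lemma Splus_lty u x : compact (closure Omega) -> usc_on (closure Omega) u ->
  Omega x -> (Splus Omega eps u x < +oo)%E.
Proof.
move=> co uu Ox; have cx := subset_closure Ox.
have [p _ pmax] := usc_on_max co (ex_intro _ x cx) uu.
have [c c0 hc] := rho_gt0_unif Ox.
apply: (@le_lt_trans _ _ ((u p - u x) / c)%:E); last exact: ltry.
apply: ge_ereal_sup => _ [y [cy _] <-]; rewrite lee_fin.
have rc := hc y cy; have r0 := lt_le_trans c0 rc.
apply: (@le_trans _ _ ((u p - u x) / rho Omega eps x y)).
  by rewrite ler_pM2r ?invr_gt0// lerB// pmax.
by rewrite ler_wpM2l ?lef_pV2// subr_ge0 pmax.
Qed.

Lemma le_Splus u v x : Omega x ->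
  (forall y, closure Omega y -> u y - u x <= v y - v x) ->
  (Splus Omega eps u x <= Splus Omega eps v x)%E.
Proof.
move=> Ox uv; have [c c0 hc] := rho_gt0_unif Ox.
apply: ge_ereal_sup => _ [y [cy xy] <-].
apply: le_trans (Splus_ge v (conj cy xy)).
by rewrite lee_fin ler_pM2r ?uv// invr_gt0 (lt_le_trans c0)// hc.
Qed.

(** Here a and c stand for the upward slopes of u and v, b and d for their
    downward slopes. Only b and c may be infinite a priori: b <= a bounds b, and
    then the last inequality bounds c and turns a <= c and d <= b into
    equalities. *)
Lemma pinch_ereal (a b c d : \bar R) :
  (0 <= a < +oo -> 0 <= b -> 0 <= d < +oo -> a <= c -> d <= b ->
  b <= a -> c - d <= a - b ->
  exists s : R, [/\ a = s%:E, c = s%:E, b <= s%:E & d <= s%:E])%E.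
Proof.
case: a => [a||]; case: b => [b||]; case: c => [c||]; case: d => [d||];
  rewrite ?(ltxx, leeNy_eq, leye_eq, andbF)//=.
rewrite -!EFinD !lee_fin => _ _ _ ac db ba h.
by exists a; rewrite !lee_fin; split=> //; [congr EFin; lra|lra].
Qed.

(** At a maximum point of u - v the increments of u are below those of v, which
    orders the slopes in the direction opposite to the hypothesis on their
    differences. *)
Lemma max_point_slopes u v x : compact (closure Omega) ->
  usc_on (closure Omega) u -> usc_on (closure Omega) (fun y => - v y) ->
  Omega x -> (forall y, closure Omega y -> u y - v y <= u x - v x) ->
  (Splus Omega eps v x - Sminus Omega eps v x <=
   Splus Omega eps u x - Sminus Omega eps u x)%E ->
  (Sminus Omega eps u x <= Splus Omega eps u x)%E ->
  exists s, [/\ Splus Omega eps u x = s%:E, Splus Omega eps v x = s%:E,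
    (Sminus Omega eps u x <= s%:E)%E & (Sminus Omega eps v x <= s%:E)%E].
Proof.
move=> co uu vv Ox xmax uv sub; apply: pinch_ereal => //.
- by rewrite Splus_ge0// Splus_lty.
- by rewrite -SplusN Splus_ge0.
- by rewrite -SplusN Splus_ge0// Splus_lty.
- by apply: le_Splus => // y cy; have := xmax y cy; lra.
- by rewrite -!SplusN; apply: le_Splus => // y cy; have := xmax y cy; lra.
Qed.

(** If s > 0, points that nearly realize the slope of u nearly maximize u - v
    while u exceeds u x there by c * s / 2 or more, c being a lower bound for
    the weight; u - v is maximized at some such point by compactness, against
    the choice of x. *)
Lemma top_contact_slope0 u v x s : compact (closure Omega) ->
  usc_on (closure Omega) u -> usc_on (closure Omega) (fun y => - v y) ->
  Omega x -> (forall y, closure Omega y -> u y - v y <= u x - v x) ->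
  (forall y, closure Omega y -> u x - v x <= u y - v y -> u y <= u x) ->
  Splus Omega eps u x = s%:E -> Splus Omega eps v x = s%:E -> s = 0.
Proof.
move=> co uu vv Ox xmax xtop us vs.
apply/eqP; rewrite eq_le -!lee_fin -{2}us Splus_ge0// andbT lee_fin leNgt.
apply/negP => s0; have [c c0 hc] := rho_gt0_unif Ox.
pose K := closure Omega `&` [set y | u x + c * s / 2 <= u y].
have approx e : 0 < e -> exists2 y, K y & u x - v x - e <= u y - v y.
  (* s / 2 keeps the slope above s / 2; e / eps makes the loss d * rho <= e *)
  move=> e0; pose d := Num.min (s / 2) (e / eps).
  have d0 : 0 < d by rewrite lt_min !divr_gt0.
  have ds : d <= s / 2 by rewrite ge_min lexx.
  have de : d * eps <= e by rewrite -ler_pdivlMr// ge_min lexx orbT.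
  have [_ [y xy <-]] : exists2 q, [set ((u y - u x) / rho Omega eps x y)%:E
      | y in path_cball Omega x eps] q & ((s - d)%:E < q)%E.
    by apply/ereal_sup_gtP; rewrite -/(Splus Omega eps u x) us lte_fin; lra.
  have [cy _] := xy; have cr := hc y cy; have re := rho_le xy.
  have r0 := lt_le_trans c0 cr.
  have := Splus_ge v xy; rewrite vs lee_fin ler_pdivrMr// => vy.
  rewrite lte_fin ltr_pdivlMr// => uy.
  exists y; [split=> //=|]; nra.
have [y0 y0K _] := approx 1 ltr01.
have Kco : compact K.
  apply: (subclosed_compact _ co); last by move=> y [].
  exact: closed_superlevel (@closed_closure _ _) uu.
have [p [cp up] pmax] := usc_on_max Kco (ex_intro _ y0 y0K)
  (usc_onW (fun y (h : K y) => h.1) (usc_onD uu vv)).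
have : u p <= u x.
  apply: xtop => //; apply/ler_addgt0Pr => e e0.
  by have [y Ky] := approx e e0; have := pmax y Ky; lra.
have : 0 < c * s by rewrite mulr_gt0.
move: up => /=; lra.
Qed.

Lemma Splus_le0 u x y : Omega x -> (Splus Omega eps u x <= 0)%E ->
  path_cball Omega x eps y -> u y <= u x.
Proof.
move=> Ox ux xy; have [c c0 hc] := rho_gt0_unif Ox.
have := le_trans (Splus_ge u xy) ux.
rewrite lee_fin pmulr_lle0 ?subr_le0// invr_gt0 (lt_le_trans c0)// hc//.
by case: xy.
Qed.

(** * The comparison principle *)

(** The set F of maximum points of u - v at which u is largest is closed, and
    vanishing of all slopes on F makes it open; when it avoids the boundary,
    connectedness spreads it over all of Omega. *)
Lemma comparison_subsolution u v : (0 < n)%N -> Omega !=set0 ->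
  bounded_set Omega -> connected Omega ->
  usc_on (closure Omega) u -> usc_on (closure Omega) (fun y => - v y) ->
  (forall x, Omega x -> (Splus Omega eps v x - Sminus Omega eps v x <=
     Splus Omega eps u x - Sminus Omega eps u x)%E) ->
  (forall x, Omega x -> (Sminus Omega eps u x <= Splus Omega eps u x)%E) ->
  exists M, is_max_on (closure Omega) (fun x => u x - v x) M /\
    is_max_on (boundary Omega) (fun x => u x - v x) M.
Proof.
move=> n0 [x0 Ox0] Ob Oconn uu vv uv sub.
have co : compact (closure Omega).
  exact: bounded_closed_compact (bounded_closure Ob) (@closed_closure _ _).
have ww := usc_onD uu vv.
have [p cp pmax] := usc_on_max co (ex_intro _ x0 (subset_closure Ox0)) ww.
(* a maximum point off Omega settles the claim *)
have [[z [cz Oz zp]]|noz] :=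
  pselect (exists z, [/\ closure Omega z, ~ Omega z & u p - v p <= u z - v z]).
  exists (u z - v z); split; split.
  - by exists z.
  - by move=> _ [y cy <-]; apply: le_trans zp; exact: pmax.
  - by exists z => //; split=> // /interior_subset.
  - by move=> _ [y [cy _] <-]; apply: le_trans zp; exact: pmax.
exfalso.
pose E := closure Omega `&` [set y | u p - v p <= u y - v y].
have Ecl : closed E by exact: closed_superlevel (@closed_closure _ _) ww.
have Eco : compact E by apply: (subclosed_compact Ecl co) => y [].
have uE : usc_on E u by apply: usc_onW uu => y [].
have [q Eq qmax] : exists2 q, E q & forall y, E y -> u y <= u q.
  by apply: usc_on_max Eco _ uE; exists p; split=> /=.
pose F := E `&` [set y | u q <= u y].
have Fcl : closed F by exact: closed_superlevel Ecl uE.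
have FO : F `<=` Omega.
  by move=> y [[cy yp] _]; apply: contrapT => Oy; apply: noz; exists y.
have Fnbhs x : F x -> nbhs x F.
  move=> Fx; have Ox := FO _ Fx; case: Fx => -[cx /= px] /= qx.
  have xmax y : closure Omega y -> u y - v y <= u x - v x.
    by move=> cy; apply: le_trans px; exact: pmax.
  have [s [us vs us' vs']] :=
    max_point_slopes co uu vv Ox xmax (uv _ Ox) (sub _ Ox).
  have s0 : s = 0.
    apply: (top_contact_slope0 co uu vv Ox xmax _ us vs) => y cy xy.
    by apply: le_trans qx; apply: qmax; split=> //; exact: le_trans xy.
  rewrite {}s0 in us vs us' vs'; move: us' vs'; rewrite -!SplusN => us' vs'.
  apply: filterS (path_cball_nbhs Ox) => y xy.
  have uy := Splus_le0 Ox us' xy.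
  have vy : v y <= v x by apply: (Splus_le0 Ox _ xy); rewrite vs.
  by split; [split; [case: xy|rewrite /=; lra]|rewrite /=; lra].
have FE : F = Omega.
  apply: Oconn; first by exists q; split=> /=.
    exists F; first by rewrite openE => x /Fnbhs.
    by rewrite setIidr.
  by exists F => //; rewrite setIidr.
(* F being closed, Omega = F contains its own boundary *)
have [z cz []] := open_bounded_boundary n0 (ex_intro _ x0 Ox0) Ob Omega_open.
by rewrite -FE; apply: Fcl; rewrite FE.
Qed.

End Slopes.

Theorem corollary2p8 (R : realType) (n : nat) (n_gt0 : (0 < n)%N)
  (Omega : set 'rV[R]_n)
  (Omega_neq0 : Omega !=set0)
  (Omega_bounded : bounded_set Omega)
  (Omega_connected : connected Omega)
  (Omega_open : open Omega)
  (Omega_diam : (path_diam Omega < +oo)%E)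
  (eps : R) (eps_gt0 : 0 < eps) (eps_lt1 : eps < 1)
  (u v : 'rV[R]_n -> R)
  (u_usc : usc_on (closure Omega) u)
  (Nv_usc : usc_on (closure Omega) (fun x => - v x))
  (le_uv : forall x, Omega x ->
    (- inf_laplace Omega eps u x <= - inf_laplace Omega eps v x)%E)
  (sub_or_super :
    (forall x, Omega x -> (- inf_laplace Omega eps u x <= 0)%E) \/
    (forall x, Omega x -> (0 <= - inf_laplace Omega eps v x)%E)) :
  exists M : R,
    is_max_on (closure Omega) (fun x => u x - v x) M /\
    is_max_on (boundary Omega) (fun x => u x - v x) M.
Proof.
have co : compact (closure Omega).
  exact: bounded_closed_compact (bounded_closure Omega_bounded)
    (@closed_closure _ _).
have finu x : Omega x -> Splus Omega eps u x \is a fin_num.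
  by move=> Ox; rewrite ge0_fin_numE ?Splus_ge0// Splus_lty.
have finv x : Omega x -> Sminus Omega eps v x \is a fin_num.
  by move=> Ox; rewrite -SplusN ge0_fin_numE ?Splus_ge0// Splus_lty.
have eps_inv : (0 < (eps^-1)%:E)%E by rewrite lte_fin invr_gt0.
have uv x : Omega x -> (Splus Omega eps v x - Sminus Omega eps v x <=
    Splus Omega eps u x - Sminus Omega eps u x)%E.
  by move=> /le_uv; rewrite leeN2 lee_pmul2l.
case: sub_or_super => [sub|super].
  apply: (comparison_subsolution Omega_open Omega_diam eps_gt0) => // x Ox.
  have := sub x Ox; rewrite oppe_le0 pmule_rge0// sube_ge0//.
  by rewrite finu ?orbT.
(* x |-> - x exchanges the two slopes, hence sub- and supersolutions *)
have -> : (fun x => u x - v x) = (fun x => - v x - - u x).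
  by apply/funext => x; rewrite opprK addrC.
apply: (comparison_subsolution Omega_open Omega_diam eps_gt0) => // [|x Ox|x Ox].
- by under eq_fun do rewrite opprK.
- rewrite !SplusN !SminusN -leeN2 oppeB ?fin_num_adde_defr ?finv//.
  rewrite oppeB; last by rewrite fin_num_adde_defl// fin_numN finu.
  by rewrite addeC [leRHS]addeC uv.
- have := super x Ox; rewrite oppe_ge0 pmule_rle0// sube_le0.
  by rewrite SplusN SminusN.
Qed.
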